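(* Let $\mathcal{M}=(E,\rho)$ be a $q$-polymatroid with denominator $\mu$. (a) A minimal spanning space of $\mathcal{M}$ is $\mu$-independent. (b) Every $\mu$-basis of $\mathcal{M}$ contains a minimal spanning space and every minimal spanning space is contained in a $\mu$-basis of $\mathcal{M}$.
   Context: Throughout, $\mathbb{F}=\mathbb{F}_q$ is a finite field and $E$ is a finite-dimensional $\mathbb{F}$-vector space. $V\leq W$ means that $V$ is a subspace of $W$, and $\mathcal{V}(E)$ is the set of all subspaces of $E$. A $q$-rank function on $E$ is a map $\rho:\mathcal{V}(E)\to\mathbb{Q}_{\geq0}$ such that for all $V,W\in\mathcal{V}(E)$: (R1) $0\leq\rho(V)\leq\dim V$; (R2) $V\leq W$ implies $\rho(V)\leq\rho(W)$; (R3) $\rho(V+W)+\rho(V\cap W)\leq\rho(V)+\rho(W)$. A $q$-polymatroid on $E$ is a pair $\mathcal{M}=(E,\rho)$ with $\rho$ a $q$-rank function on $E$. A number $\mu\in\mathbb{Q}_{>0}$ is a denominator of $\mathcal{M}$ if $\mu\rho(V)\in\mathbb{N}_0$ for all $V\in\mathcal{V}(E)$. Let $\mathcal{M}=(E,\rho)$ be a $q$-polymatroid with denominator $\mu$. A space $I\in\mathcal{V}(E)$ is $\mu$-independent if $\rho(J)\geq\frac{\dim J}{\mu}$ for all subspaces $J\leq I$. A $\mu$-basis of $\mathcal{M}$ is a $\mu$-independent subspace of $E$ of maximal dimension among all $\mu$-independent subspaces of $E$. A subspace $V\in\mathcal{V}(E)$ is a spanning space if $\rho(V)=\rho(E)$;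 it is a minimal spanning space if it is a spanning space and no proper subspace of $V$ is a spanning space. *)

(* Defs.v *)
From mathcomp Require Import all_boot all_order all_algebra.

Set Implicit Arguments.
Unset Strict Implicit.
Unset Printing Implicit Defensive.

Import Order.TTheory GRing.Theory Num.Theory.
Local Open Scope ring_scope.

(* Nonnegativity of the values is the first half of [qrank_bounds]. *)
Record qPolymatroid (F : finFieldType) (E : vectType F) := QPolymatroid {
  qrank :> {vspace E} -> rat;
  qrank_bounds : forall V : {vspace E}, 0 <= qrank V <= (\dim V)%:R;
  qrank_mono : forall V W : {vspace E}, (V <= W)%VS -> qrank V <= qrank W;
  qrank_submod : forall V W : {vspace E},
    qrank (V + W)%VS + qrank (V :&: W)%VS <= qrank V + qrank W
}.

Section Notions.

Variables (F : finFieldType) (E : vectType F) (M : qPolymatroid E).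

Definition denominator (mu : rat) : Prop :=
  0 < mu /\ forall V : {vspace E}, mu * M V \is a Num.nat.

Definition independent (mu : rat) (I : {vspace E}) : Prop :=
  forall J : {vspace E}, (J <= I)%VS -> (\dim J)%:R / mu <= M J.

Definition mu_basis (mu : rat) (B : {vspace E}) : Prop :=
  independent mu B /\
  forall I : {vspace E}, independent mu I -> (\dim I <= \dim B)%N.

Definition spanning (V : {vspace E}) : Prop := M V = M fullv.

Definition minimal_spanning (V : {vspace E}) : Prop :=
  spanning V /\
  forall W : {vspace E}, (W <= V)%VS -> W != V -> ~ spanning W.

End Notions.

(* Main.v *)
Require Import Defs.
From mathcomp Require Import all_boot all_order all_algebra.
From Stdlib Require Import Classical.
From mathcomp Require Import zify.

(** Put [f V = mu * M V]; it is a monotone submodular function with natural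
    number values, and [I] is independent exactly when [\dim J <= f J] for all
    [J <= I].

    A minimal spanning space [V] is independent because a minimal [J <= V] with
    [f J < \dim J] has, by integrality of [f], a hyperplane [H] of the same rank
    as [J]; extending [H] by a complement of [J] in [V] gives a proper subspace
    of [V], which still spans by submodularity ([minimal_spanning_dim_le]).

    The rest is a rank duality.  The quantity
      [r V = min_(X <= V) (f X + \dim V - \dim X)]
    is the rank function of a q-matroid with the same independent spaces.  Any
    [X] bounds the dimension of every independent space [I] by
    [f X + \dim E - \dim X] ([indep_dim_le]).  If [B] is independent and cannot
    be enlarged, then [r (B + <[x]>) = \dim B] for every [x], and submodularity
    of [r] propagates this to [E]: the bound is attained by [B] for a suitable
    [X] ([maximal_indep_certificate]).  Such a certificate [X] shows at once that
    [B] has the largest possible dimension, so that enlarging a minimal spanning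
    space as far as possible produces a mu-basis, and, by submodularity applied
    to [X] and [B], that [B] spans ([certificate_spanning]). *)

Set Implicit Arguments.
Unset Strict Implicit.
Unset Printing Implicit Defensive.

Import Order.TTheory GRing.Theory Num.Theory.
Local Open Scope ring_scope.

Section Subspaces.

Variables (F : fieldType) (E : vectType F).
Implicit Types (P : {vspace E} -> Prop) (U V W : {vspace E}).

Lemma dimv_proper U V : (U <= V)%VS -> U != V -> (\dim U < \dim V)%N.
Proof.
move=> sUV neUV; rewrite ltn_neqAle dimvS // andbT.
by apply: contra neUV => /eqP dUV; rewrite eqEdim sUV dUV leqnn.
Qed.

Lemma exists_minimal_subspace P V : P V ->
  exists W, [/\ (W <= V)%VS, P W &
    forall U, (U <= W)%VS -> U != W -> ~ P U].
Proof.
have [n] := ubnP (\dim V); elim: n V => // n IHn V ltVn PV.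
have [[U [sUV neUV PU]]|noU] :=
  classic (exists U, [/\ (U <= V)%VS, U != V & P U]).
  have [|W [sWU PW minW]] := IHn U _ PU.
    by have := dimv_proper sUV neUV; lia.
  by exists W; split=> //; apply: subv_trans sUV.
by exists V; split=> // U sUV neUV PU; apply: noU; exists U.
Qed.

Lemma exists_maximal_superspace P V : P V ->
  exists W, [/\ (V <= W)%VS, P W &
    forall U, (W <= U)%VS -> U != W -> ~ P U].
Proof.
have [n] := ubnP (\dim {:E} - \dim V); elim: n V => // n IHn V ltVn PV.
have [[U [sVU neUV PU]]|noU] :=
  classic (exists U, [/\ (V <= U)%VS, U != V & P U]).
  have [|W [sUW PW maxW]] := IHn U _ PU.
    rewrite eq_sym in neUV.
    by have := dimv_proper sVU neUV; have := dimvS (subvf U); lia.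
  by exists W; split=> //; apply: subv_trans sUW.
by exists V; split=> // U sVU neUV PU; apply: noU; exists U.
Qed.

Lemma exists_hyperplane V : (0 < \dim V)%N ->
  exists H, [/\ (H <= V)%VS, H != V & (\dim V <= (\dim H).+1)%N].
Proof.
move=> V_gt0; set x := vpick V.
have x_neq0 : x != 0 by rewrite vpick0 -dimv_eq0 -lt0n.
exists (V :\: <[x]>)%VS; split; first exact: diffvSl.
  apply: contraNneq x_neq0 => eqV.
  have : x \in ((V :\: <[x]>) :&: <[x]>)%VS.
    by rewrite memv_cap memv_line andbT eqV memv_pick.
  by rewrite capv_diff memv0.
have : (V <= (V :\: <[x]>) + <[x]>)%VS by rewrite addv_diff addvSl.
move/dimvS=> leV.
have [+ _] := dimv_add_leqif (V :\: <[x]>)%VS <[x]>%VS; rewrite dim_vline x_neq0.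
lia.
Qed.

End Subspaces.

Section ScaledRank.

Variables (F : finFieldType) (E : vectType F) (M : qPolymatroid E) (mu : rat).
Hypothesis hmu : denominator M mu.
Implicit Types (B H I J U V W X Y Z : {vspace E}).

Definition scaled_rank V : nat := Num.truncn (mu * M V).
Local Notation f := scaled_rank.

Lemma scaled_rankE V : (f V)%:R = mu * M V.
Proof. by case: hmu => _ /(_ V) /truncnK. Qed.

Lemma scaled_rank_mono V W : (V <= W)%VS -> (f V <= f W)%N.
Proof.
case: hmu => mu_gt0 _ sVW.
by rewrite -(ler_nat rat) !scaled_rankE ler_pM2l // qrank_mono.
Qed.

Lemma scaled_rank_submod V W : (f (V + W)%VS + f (V :&: W)%VS <= f V + f W)%N.
Proof.
case: hmu => mu_gt0 _.
by rewrite -(ler_nat rat) !natrD !scaled_rankE -!mulrDr ler_pM2l // qrank_submod.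
Qed.

Lemma scaled_rank0 : f 0%VS = 0%N.
Proof.
apply/eqP; rewrite -(eqr_nat rat) scaled_rankE mulf_eq0.
by have := qrank_bounds M 0%VS; rewrite dimv0 -eq_le eq_sym => ->; rewrite orbT.
Qed.

Lemma spanning_scaled V : (f {:E}%VS <= f V)%N -> spanning M V.
Proof.
case: hmu => mu_gt0 _.
rewrite -(ler_nat rat) !scaled_rankE ler_pM2l // => leEV.
by apply/eqP; rewrite eq_le leEV qrank_mono // subvf.
Qed.

Lemma independent_scaled I :
  independent M mu I <-> forall J, (J <= I)%VS -> (\dim J <= f J)%N.
Proof.
case: hmu => mu_gt0 _.
have dimE J : ((\dim J)%:R / mu <= M J) = (\dim J <= f J)%N.
  by rewrite ler_pdivrMr // mulrC -scaled_rankE ler_nat.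
by split=> indI J sJI; have := indI J sJI; rewrite dimE.
Qed.

Lemma minimal_spanning_dim_le V J :
  minimal_spanning M V -> (J <= V)%VS -> (\dim J <= f J)%N.
Proof.
move=> [spV minV] sJV; have [//|ltJ] := leqP (\dim J) (f J).
have [C [sCJ ltC minC]] :=
  exists_minimal_subspace (P := fun U => (f U < \dim U)%N) (V := J) ltJ.
have sCV := subv_trans sCJ sJV.
have [H [sHC neHC dimH]] := exists_hyperplane (leq_ltn_trans (leq0n _) ltC).
have geH : (\dim H <= f H)%N by have [//|/(minC _ sHC neHC)] := leqP.
(* Integrality: [f C < \dim C <= \dim H + 1] leaves no room for [f H < f C]. *)
have leCH : (f C <= f H)%N by lia.
pose W := (H + (V :\: C))%VS.
have WC : (W :&: C)%VS = H.
  by rewrite /W -vspace_modl // capv_diff addv0.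
have sVW : (V <= W + C)%VS.
  by rewrite /W -addvA addv_diff; apply: subv_trans (addvSl V C) (addvSr _ _).
have neWV : W != V.
  by apply: contraNneq neHC => eqWV; rewrite -WC eqWV; apply/eqP/capv_idPr.
have sWV : (W <= V)%VS by rewrite subv_add (subv_trans sHC) // diffvSl.
exfalso; apply: (minV W sWV neWV); apply: spanning_scaled.
have <- : f V = f {:E}%VS by rewrite /scaled_rank spV.
have := scaled_rank_submod W C; have := scaled_rank_mono sVW.
by rewrite WC; lia.
Qed.

(** The easy half of the duality: [f X] bounds the part of [I] inside [X], and
    the codimension of [X] bounds the rest. *)
Lemma indep_dim_le I V X : independent M mu I -> (I <= V)%VS -> (X <= V)%VS ->
  (\dim I + \dim X <= f X + \dim V)%N.
Proof.
move=> /independent_scaled indI sIV sXV.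
have := indI _ (capvSl I X).
have := scaled_rank_mono (capvSr I X).
have := dimv_sum_cap I X.
have : (\dim (I + X) <= \dim V)%N by rewrite dimvS // subv_add sIV.
lia.
Qed.

(** [X] witnesses that no independent subspace of [V] is larger than [B]. *)
Definition certificate B V X : Prop :=
  (X <= V)%VS /\ (f X + \dim V <= \dim X + \dim B)%N.

(** Submodularity of the induced rank function [r]: from [r V] and [r W] at
    most [\dim B], and [r (V :&: W)] at least [\dim B]
    because [V :&: W] contains the independent space [B], one gets
    [r (V + W)] at most [\dim B]. *)
Lemma certificate_add B V W X Y : independent M mu B ->
  (B <= V)%VS -> (B <= W)%VS -> certificate B V X -> certificate B W Y ->
  certificate B (V + W)%VS (X + Y)%VS.
Proof.
move=> indB sBV sBW [sXV leX] [sYW leY]; split; first exact: addvS.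
have sBVW : (B <= V :&: W)%VS by rewrite subv_cap sBV.
have := indep_dim_le indB sBVW (capvS sXV sYW).
have := scaled_rank_submod X Y.
have := dimv_sum_cap X Y.
have := dimv_sum_cap V W.
lia.
Qed.

Lemma maximal_indep_certificate B : independent M mu B ->
  (forall U, (B <= U)%VS -> U != B -> ~ independent M mu U) ->
  exists X, certificate B fullv X.
Proof.
move=> indB maxB.
have certB : certificate B B 0%VS.
  by split; [exact: sub0v | rewrite scaled_rank0 dimv0].
have cert_line x : exists X, certificate B (B + <[x]>)%VS X.
  have [eqB|neB] := eqVneq (B + <[x]>)%VS B; first by exists 0%VS; rewrite eqB.
  have /not_all_ex_not[J nJ] :
      ~ forall J, (J <= B + <[x]>)%VS -> (\dim J <= f J)%N.
    by move/independent_scaled; apply: maxB (addvSl _ _) neB.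
  have [sJ /negP] := imply_to_and _ _ nJ; rewrite -ltnNge => ltJ.
  exists J; split=> //.
  have [+ _] := dimv_add_leqif B <[x]>%VS; rewrite dim_vline.
  by case: (x != 0) => /=; lia.
have cert_span s : exists X, certificate B (B + <<s>>)%VS X.
  elim: s => [|x s [X certX]]; first by exists 0%VS; rewrite span_nil addv0.
  have [Y certY] := cert_line x; exists (Y + X)%VS.
  have -> : (B + <<x :: s>> = (B + <[x]>) + (B + <<s>>))%VS.
    rewrite span_cons -addvA (addvA <[x]>%VS) (addvC <[x]>%VS B).
    by rewrite -addvA (addvA B B) addvv.
  by apply: certificate_add; rewrite ?addvSl.
have [X] := cert_span (vbasis {:E}%VS).
rewrite (span_basis (vbasisP _)) (_ : (B + fullv)%VS = fullv); first by exists X.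
by apply/addv_idPr/subvf.
Qed.

(** Comparing [f (X :&: B) >= \dim (X :&: B)] with the value of [f X] forces
    [X + B = E] and [f (X :&: B) = f X], so [B] gains nothing from [X]. *)
Lemma certificate_spanning B X :
  independent M mu B -> certificate B fullv X -> spanning M B.
Proof.
move=> /independent_scaled indB [_ leX]; apply: spanning_scaled.
have := indB _ (capvSr X B).
have := scaled_rank_mono (capvSl X B).
have := scaled_rank_submod X B.
have := dimv_sum_cap X B.
have := dimvS (subvf (X + B)).
have [eqXB|neXB] := eqVneq (X + B)%VS fullv; first by rewrite eqXB; lia.
by have := dimv_proper (subvf _) neXB; lia.
Qed.

Lemma maximal_indep_mu_basis B : independent M mu B ->
  (forall U, (B <= U)%VS -> U != B -> ~ independent M mu U) -> mu_basis M mu B.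
Proof.
move=> indB maxB; split=> // I indI.
have [X [_ leX]] := maximal_indep_certificate indB maxB.
by have := indep_dim_le indI (subvf I) (subvf X); lia.
Qed.

Lemma mu_basis_spanning B : mu_basis M mu B -> spanning M B.
Proof.
move=> [indB maxB].
have [|X certX] := maximal_indep_certificate indB; last first.
  exact: certificate_spanning certX.
move=> U sBU neUB /maxB; rewrite leqNgt => /negP; apply.
by apply: dimv_proper; rewrite // eq_sym.
Qed.

End ScaledRank.

Theorem proposition5p4 (F : finFieldType) (E : vectType F)
    (M : qPolymatroid E) (mu : rat) (hmu : denominator M mu) :
  (forall V : {vspace E}, minimal_spanning M V -> independent M mu V) /\
  ((forall B : {vspace E}, mu_basis M mu B ->
      exists V : {vspace E}, minimal_spanning M V /\ (V <= B)%VS) /\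
   (forall V : {vspace E}, minimal_spanning M V ->
      exists B : {vspace E}, mu_basis M mu B /\ (V <= B)%VS)).
Proof.
have indep V : minimal_spanning M V -> independent M mu V.
  move=> minV; apply/(independent_scaled hmu) => J.
  exact: (minimal_spanning_dim_le hmu).
split=> //; split=> [B /(mu_basis_spanning hmu) spB | V /indep indV].
  have [V [sVB spV minV]] := exists_minimal_subspace spB.
  by exists V; split.
have [B [sVB indB maxB]] := exists_maximal_superspace indV.
by exists B; split=> //; apply: maximal_indep_mu_basis.
Qed.
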